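(* Let $T$ be a tolerance of a lattice $L$ and denote $R := {\leq}\circ T\circ{\leq}$. Then the Dedekind–MacNeille completion $\mathrm{DM}(L/T)$ of the factor lattice $L/T$ is isomorphic (as a lattice) to the concept lattice $\mathcal{L}(L,L,R)$.
   Context: $L$ is an arbitrary (not necessarily complete) lattice with order $\leq$. Binary relations are composed by: $(x,y)\in R\circ S$ iff there is $z$ with $(x,z)\in R$ and $(z,y)\in S$. A binary relation on $L$ is compatible if it is a sublattice of $L^2=L\times L$. A tolerance of $L$ is a reflexive, symmetric, compatible relation $T\subseteq L^2$. A block of $T$ is a maximal (with respect to inclusion) nonempty set $X\subseteq L$ with $X\times X\subseteq T$; blocks are convex sublattices of $L$. For $X\subseteq L$, $(X]$ and $[X)$ denote the ideal and the filter of $L$ generated by $X$. The factor lattice $L/T$ (Czédli) is the set of all blocks of $T$ ordered by $B\leq C$ iff $(B]\subseteq (C]$ (equivalently $[B)\supseteq [C)$); this is a lattice, in which $B\vee C$ is the unique block containing $\{b\vee c : b\in B, c\in C\}$ and $B\wedge C$ is the unique block containing $\{b\wedge c : b\in B, c\in C\}$. For a formal context $(G,M,I)$ ($G,M$ sets, $I\subseteq G\times M$), put $A^I=\{m\in M : (g,m)\in I \text{ for all } g\in A\}$ for $A\subseteq G$ and ${}^I B=\{g\in G : (g,m)\in I\text{ for all } m\in B\}$ for $B\subseteq M$. A concept of $(G,M,I)$ is a pair $(A,B)$ with $A\subseteq G$, $B\subseteq M$, $A^I=B$ and ${}^IB=A$ ($A$ or $B$ may be empty). The concept lattice $\mathcal{L}(G,M,I)$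 is the set of all concepts ordered by $(A_1,B_1)\leq(A_2,B_2)$ iff $A_1\subseteq A_2$ (iff $B_1\supseteq B_2$); it is a complete lattice. The Dedekind–MacNeille completion $\mathrm{DM}(K)$ of a lattice $K$ is isomorphic to $\mathcal{L}(K,K,\leq)$. *)

(* Defs.v *)
From HB Require Import structures.
From mathcomp Require Import all_boot all_order.
From mathcomp Require Import boolp classical_sets.

Set Implicit Arguments.
Unset Strict Implicit.
Unset Printing Implicit Defensive.

Import Order.TTheory.

Local Open Scope classical_set_scope.
Local Open Scope order_scope.

(* [rcomp R S] is "first R, then S"; the infix [\;] of [relation_scope] takes
   its arguments in the opposite order. *)
Definition rcomp (X Y Z : Type) (R : set (X * Y)) (S : set (Y * Z)) :
  set (X * Z) := (S \; R)%relation.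

Definition le_rel (d : Order.disp_t) (L : porderType d) : set (L * L) :=
  [set xy | xy.1 <= xy.2].

Arguments le_rel {d} L.

Section Tolerances.
Context (d : Order.disp_t) (L : latticeType d).

Definition compatible (R : set (L * L)) :=
  forall p q : L * L, R p -> R q ->
    R (p.1 `&` q.1, p.2 `&` q.2) /\ R (p.1 `|` q.1, p.2 `|` q.2).

Record tolerance := Tolerance {
  tol_rel :> set (L * L);
  tol_refl : forall x, tol_rel (x, x);
  tol_sym : forall x y, tol_rel (x, y) -> tol_rel (y, x);
  tol_compat : compatible tol_rel }.

(* The empty set is not excluded; ideals are only generated by blocks, which are
   nonempty. *)
Definition is_ideal (I : set L) :=
  (forall x y, x <= y -> I y -> I x) /\
  (forall x y, I x -> I y -> I (x `|` y)).

Definition ideal (X : set L) : set L := smallest is_ideal X.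

Definition tol_clique (T : set (L * L)) (X : set L) :=
  X !=set0 /\ X `*` X `<=` T.

Definition is_block (T : set (L * L)) (X : set L) :=
  tol_clique T X /\ forall Y, tol_clique T Y -> X `<=` Y -> Y = X.

Record factor (T : tolerance) := Block {
  block :> set L;
  blockP : is_block T block }.

End Tolerances.

Section FactorLattice.
Context (d : Order.disp_t) (L : latticeType d) (T : tolerance L).
Implicit Types B C D : factor T.

Lemma block_neq0 B : block B !=set0.
Proof. by case: B => B [[]]. Qed.

Lemma block_tol B x y : block B x -> block B y -> tol_rel T (x, y).
Proof. by case: B => B [[_ BT] _] /= Bx By; apply: BT. Qed.

Lemma block_max B x : (forall y, block B y -> tol_rel T (x, y)) -> block B x.
Proof.
case: B => B [[[b Bb] BT] Bmax] /= xT.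
suff {1}<- : (B `|` [set x] = B)%classic by right.
apply: Bmax; last by move=> y; left.
split; first by exists b; left.
move=> [y z] /= [[By|->] [Bz|->]]; first exact: BT.
- exact/tol_sym/xT.
- exact: xT.
- exact: tol_refl.
Qed.

Lemma block_inj B C : B = C :> set L -> B = C.
Proof.
case: B C => [B PB] [C PC] /= BC; subst C.
by congr Block; apply: Prop_irrelevance.
Qed.

Lemma tolI x x' y y' :
  tol_rel T (x, y) -> tol_rel T (x', y') -> tol_rel T (x `&` x', y `&` y').
Proof. by move=> h h'; have [] := tol_compat h h'. Qed.

Lemma tolU x x' y y' :
  tol_rel T (x, y) -> tol_rel T (x', y') -> tol_rel T (x `|` x', y `|` y').
Proof. by move=> h h'; have [] := tol_compat h h'. Qed.

Lemma blockU B x y : block B x -> block B y -> block B (x `|` y).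
Proof.
move=> Bx By; apply: block_max => z Bz; rewrite -(joinxx z).
by apply: tolU; exact: block_tol Bz.
Qed.

Lemma block_convex B x y z :
  x <= y -> y <= z -> block B x -> block B z -> block B y.
Proof.
move=> xy yz Bx Bz; apply: block_max => w Bw.
have Bzw := blockU Bz Bw.
have lrT : tol_rel T (x `&` w, z `|` w).
  by rewrite -(meetxx (z `|` w)); apply: tolI; exact: block_tol Bzw.
have itvT u : x `&` w <= u -> u <= z `|` w -> tol_rel T (u, z `|` w).
  move=> lu ur; have := tolU lrT (tol_refl T u).
  by rewrite (join_r lu) (join_l ur).
have yr : y <= z `|` w := le_trans yz (leUl z w).
have yT := itvT y (le_trans (leIl x w) xy) yr.
have wT := tol_sym (itvT w (leIr w x) (leUr w z)).
by have := tolI yT wT; rewrite (meet_l yr) (meet_r (leUr w z)).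
Qed.

Lemma ideal_blockE B : ideal B = [set x | exists2 b, block B b & x <= b].
Proof.
apply/seteqP; split=> [x|x [b Bb xb]].
  apply: smallest_sub => [|y By]; last by exists y.
  split=> [y z yz [b Bb zb]|y z [b Bb yb] [c Bc zc]].
    by exists b => //; apply: le_trans zb.
  by exists (b `|` c); [apply: blockU | apply: leU2].
by move=> I [[Idown _] BI]; apply: Idown xb _; apply: BI.
Qed.

Definition factor_le B C := `[< ideal B `<=` ideal C >].

Lemma factor_leP B C :
  reflect (forall b, block B b -> exists2 c, block C c & b <= c)
    (factor_le B C).
Proof.
rewrite /factor_le !ideal_blockE; apply: (iffP (asboolP _)) => [sBC b Bb|BC x].
  by apply: (sBC b); exists b.
by move=> [b /BC[c Cc bc] xb]; exists c => //; apply: le_trans bc.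
Qed.

Lemma factor_geP B C :
  reflect (forall c, block C c -> exists2 b, block B b & b <= c)
    (factor_le B C).
Proof.
apply: (iffP (factor_leP B C)) => [BC c Cc|CB b Bb].
  have [b Bb] := block_neq0 B; exists (b `&` c); last exact: leIr.
  apply: block_max => b' Bb'; have [c' Cc' b'c'] := BC b' Bb'.
  by rewrite -(meet_l b'c'); apply: tolI;
  [exact: block_tol Bb'|exact: block_tol Cc'].
have [c Cc] := block_neq0 C; exists (b `|` c); last exact: leUl.
apply: block_max => c' Cc'; have [b' Bb' b'c'] := CB c' Cc'.
by rewrite -(join_r b'c'); apply: tolU;
  [exact: block_tol Bb'|exact: block_tol Cc'].
Qed.

Lemma factor_le_refl : reflexive factor_le.
Proof. by move=> B; apply/asboolP. Qed.

Lemma factor_le_trans : transitive factor_le.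
Proof.
by move=> B A C /asboolP AB /asboolP BC; apply/asboolP; apply: subset_trans BC.
Qed.

Lemma factor_le_anti : antisymmetric factor_le.
Proof.
suff sub B C : factor_le B C -> factor_le C B -> B `<=` C.
  by move=> B C /andP[BC CB]; apply/block_inj/seteqP; split; apply: sub.
move=> BC CB b Bb; have [c Cc bc] := factor_leP _ _ BC b Bb.
have [c' Cc' c'b] := factor_geP _ _ CB b Bb.
exact: block_convex c'b bc Cc' Cc.
Qed.

Lemma block_exists (X : set L) :
  tol_clique T X -> exists B : factor T, X `<=` B.
Proof.
move=> [X0 XT].
have [|A [AT Amax]] :=
  @Zorn_bigcup L [set Y | (X `|` Y)%classic `*` (X `|` Y)%classic `<=` T].
  move=> F FP Ftot [x y] /= [[Xx|[Y FY Yx]] [Xy|[Z FZ Zy]]].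
  - exact: XT.
  - by apply: (FP _ FZ); split; [left|right].
  - by apply: (FP _ FY); split; [right|left].
  - have [YZ|ZY] := Ftot _ _ FY FZ.
    + by apply: (FP _ FZ); split; right => //; apply: YZ.
    + by apply: (FP _ FY); split; right => //; apply: ZY.
have XAP : is_block T (X `|` A)%classic.
  split=> [|Y [Y0 YT] XAY].
    by split=> //; have [x Xx] := X0; exists x; left.
  apply/seteqP; split=> //; move=> y Yy; apply: contrapT => nXAy.
  apply: (Amax Y).
    split; first by move=> a Aa; apply: XAY; right.
    by move=> /(_ y Yy) Ay; apply: nXAy; right.
  have XYE : (X `|` Y = Y)%classic.
    by apply/setUidPr => x Xx; apply: XAY; left.
  by rewrite /= XYE.
by exists (Block XAP); apply: subsetUl.
Qed.

Lemma factor_meet_exists B C :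
  exists D : factor T, [set b `&` c | b in B & c in C] `<=` D.
Proof.
apply: block_exists; split.
  have [[b Bb] [c Cc]] := (block_neq0 B, block_neq0 C).
  by exists (b `&` c), b => //; exists c.
move=> [_ _] /= [[b Bb [c Cc <-]] [b' Bb' [c' Cc' <-]]].
by apply: tolI;
  [exact: block_tol Bb'|exact: block_tol Cc'].
Qed.

Lemma factor_join_exists B C :
  exists D : factor T, [set b `|` c | b in B & c in C] `<=` D.
Proof.
apply: block_exists; split.
  have [[b Bb] [c Cc]] := (block_neq0 B, block_neq0 C).
  by exists (b `|` c), b => //; exists c.
move=> [_ _] /= [[b Bb [c Cc <-]] [b' Bb' [c' Cc' <-]]].
by apply: tolU;
  [exact: block_tol Bb'|exact: block_tol Cc'].
Qed.

Definition factor_meet B C : factor T := sval (cid (factor_meet_exists B C)).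

Definition factor_join B C : factor T := sval (cid (factor_join_exists B C)).

Lemma factor_meetP D B C :
  factor_le D (factor_meet B C) = factor_le D B && factor_le D C.
Proof.
rewrite /factor_meet; case: cid => M /= BCM.
apply/idP/andP => [DM|[DB DC]].
  split; apply: factor_le_trans DM _; apply/factor_geP => x.
    move=> Bx; have [c Cc] := block_neq0 C.
    by exists (x `&` c); [apply: BCM; exists x => //; exists c|apply: leIl].
  move=> Cx; have [b Bb] := block_neq0 B.
  by exists (b `&` x); [apply: BCM; exists b => //; exists x|apply: leIr].
apply/factor_leP => x Dx.
have [b Bb xb] := factor_leP _ _ DB x Dx.
have [c Cc xc] := factor_leP _ _ DC x Dx.
exists (b `&` c); last by rewrite lexI xb.
by apply: BCM; exists b => //; exists c.
Qed.

Lemma factor_joinP B C D :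
  factor_le (factor_join B C) D = factor_le B D && factor_le C D.
Proof.
rewrite /factor_join; case: cid => J /= BCJ.
apply/idP/andP => [JD|[BD CD]].
  split; apply: factor_le_trans JD; apply/factor_leP => x.
    move=> Bx; have [c Cc] := block_neq0 C.
    by exists (x `|` c); [apply: BCJ; exists x => //; exists c|apply: leUl].
  move=> Cx; have [b Bb] := block_neq0 B.
  by exists (b `|` x); [apply: BCJ; exists b => //; exists x|apply: leUr].
apply/factor_geP => x Dx.
have [b Bb bx] := factor_geP _ _ BD x Dx.
have [c Cc cx] := factor_geP _ _ CD x Dx.
exists (b `|` c); last by rewrite leUx bx.
by apply: BCJ; exists b => //; exists c.
Qed.

HB.instance Definition _ := gen_eqMixin (factor T).
HB.instance Definition _ := gen_choiceMixin (factor T).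
HB.instance Definition _ := Order.Le_isPOrder.Build (Order.Disp tt tt)
  (factor T) factor_le_refl factor_le_anti factor_le_trans.
HB.instance Definition _ := Order.POrder_MeetJoin_isLattice.Build
  (Order.Disp tt tt) (factor T) factor_meetP factor_joinP.

End FactorLattice.

Section ConceptLattice.
Local Open Scope classical_set_scope.
Context (G M : Type) (I : set (G * M)).

Definition common_attr (A : set G) : set M :=
  [set m | forall g, A g -> I (g, m)].

Definition common_obj (B : set M) : set G :=
  [set g | forall m, B m -> I (g, m)].

Record concept := Concept {
  extent : set G;
  intent : set M;
  extentK : common_attr extent = intent;
  intentK : common_obj intent = extent }.

Implicit Types p q r : concept.

Lemma extent_inj : injective extent.
Proof.
case=> [A B AB BA] [A' B' AB' BA'] /= AA'.
have BB' : B = B' by rewrite -AB -AB' AA'.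
move: AB' BA'; rewrite -AA' -BB' => AB' BA'.
by congr Concept; apply: Prop_irrelevance.
Qed.

Definition concept_le p q := `[< extent p `<=` extent q >].

Lemma concept_geE p q : concept_le p q = `[< intent q `<=` intent p >].
Proof.
apply/asboolP/asboolP => [pq|qp].
  by rewrite -!extentK => m mq g /pq; apply: mq.
by rewrite -!intentK => g gp m /qp; apply: gp.
Qed.

Lemma concept_le_refl : reflexive concept_le.
Proof. by move=> p; apply/asboolP. Qed.

Lemma concept_le_anti : antisymmetric concept_le.
Proof.
move=> p q /andP[/asboolP pq /asboolP qp].
by apply/extent_inj/seteqP; split.
Qed.

Lemma concept_le_trans : transitive concept_le.
Proof.
by move=> q p r /asboolP pq /asboolP qr; apply/asboolP; apply: subset_trans qr.
Qed.

Lemma common_objK p q :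
  common_obj (common_attr (extent p `&` extent q)) = extent p `&` extent q.
Proof.
apply/seteqP; split=> [g gpq|g gpq m]; last exact.
by split; rewrite -intentK => m; rewrite -extentK => mp;
  apply: gpq => h [hp hq]; apply: mp.
Qed.

Lemma common_attrK p q :
  common_attr (common_obj (intent p `&` intent q)) = intent p `&` intent q.
Proof.
apply/seteqP; split=> [m mpq|m mpq g]; last exact.
by split; rewrite -extentK => g; rewrite -intentK => gp;
  apply: mpq => n [np nq]; apply: gp.
Qed.

Definition concept_meet p q : concept := Concept erefl (common_objK p q).

Definition concept_join p q : concept := Concept (common_attrK p q) erefl.

Lemma concept_meetP r p q :
  concept_le r (concept_meet p q) = concept_le r p && concept_le r q.
Proof.
apply/asboolP/andP => /= [rpq|[/asboolP rp /asboolP rq]].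
  by split; apply/asboolP => g /rpq[].
by rewrite subsetI.
Qed.

Lemma concept_joinP p q r :
  concept_le (concept_join p q) r = concept_le p r && concept_le q r.
Proof.
rewrite !concept_geE; apply/asboolP/andP => /= [rpq|[/asboolP rp /asboolP rq]].
  by split; apply/asboolP => m /rpq[].
by rewrite subsetI.
Qed.

HB.instance Definition _ := gen_eqMixin concept.
HB.instance Definition _ := gen_choiceMixin concept.
HB.instance Definition _ := Order.Le_isPOrder.Build (Order.Disp tt tt)
  concept concept_le_refl concept_le_anti concept_le_trans.
HB.instance Definition _ := Order.POrder_MeetJoin_isLattice.Build
  (Order.Disp tt tt) concept concept_meetP concept_joinP.

End ConceptLattice.

(* Dedekind-MacNeille completion by cuts: the sets A with (A^u)^l = A, ordered
   by inclusion. *)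
Section DedekindMacNeille.
Local Open Scope classical_set_scope.
Context (d : Order.disp_t) (K : porderType d).

Record DM := Cut {
  cut :> set K;
  cutP : lbound (ubound cut) = cut }.

Implicit Types A B C : DM.

Lemma cut_inj : injective cut.
Proof.
case=> [A PA] [B PB] /= AB; subst B.
by congr Cut; apply: Prop_irrelevance.
Qed.

Definition DM_le A B := `[< A `<=` B >].

Lemma DM_le_refl : reflexive DM_le.
Proof. by move=> A; apply/asboolP. Qed.

Lemma DM_le_anti : antisymmetric DM_le.
Proof.
by move=> A B /andP[/asboolP AB /asboolP BA]; apply/cut_inj/seteqP; split.
Qed.

Lemma DM_le_trans : transitive DM_le.
Proof.
by move=> B A C /asboolP AB /asboolP BC; apply/asboolP; apply: subset_trans BC.
Qed.

Lemma lbound_ubound_mono (X Y : set K) :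
  X `<=` Y -> lbound (ubound X) `<=` lbound (ubound Y).
Proof. by move=> XY x xX y yY; apply: xX => z /XY; apply: yY. Qed.

Lemma sub_lbound_ubound (X : set K) : X `<=` lbound (ubound X).
Proof. by move=> x Xx y; apply. Qed.

Lemma DM_meet_cut A B : lbound (ubound (A `&` B)) = A `&` B.
Proof.
apply/seteqP; split; last exact: sub_lbound_ubound.
by rewrite subsetI -{2}(cutP A) -{3}(cutP B); split;
  apply: lbound_ubound_mono; [apply: subIsetl|apply: subIsetr].
Qed.

Lemma DM_join_cut A B :
  lbound (ubound (lbound (ubound (A `|` B)))) = lbound (ubound (A `|` B)).
Proof.
apply/seteqP; split; last exact: sub_lbound_ubound.
by move=> x xAB y yAB; apply: xAB => z; apply.
Qed.

Definition DM_meet A B : DM := Cut (DM_meet_cut A B).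

Definition DM_join A B : DM := Cut (DM_join_cut A B).

Lemma DM_meetP C A B : DM_le C (DM_meet A B) = DM_le C A && DM_le C B.
Proof.
apply/asboolP/andP => /= [CAB|[/asboolP CA /asboolP CB]].
  by split; apply/asboolP => x /CAB[].
by rewrite subsetI.
Qed.

Lemma DM_joinP A B C : DM_le (DM_join A B) C = DM_le A C && DM_le B C.
Proof.
apply/asboolP/andP => /= [ABC|[/asboolP AC /asboolP BC]].
  by split; apply/asboolP => x ABx; apply/ABC/sub_lbound_ubound; [left|right].
by rewrite -(cutP C); apply: lbound_ubound_mono; rewrite subUset.
Qed.

HB.instance Definition _ := gen_eqMixin DM.
HB.instance Definition _ := gen_choiceMixin DM.
HB.instance Definition _ := Order.Le_isPOrder.Build (Order.Disp tt tt)
  DM DM_le_refl DM_le_anti DM_le_trans.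
HB.instance Definition _ := Order.POrder_MeetJoin_isLattice.Build
  (Order.Disp tt tt) DM DM_meetP DM_joinP.

End DedekindMacNeille.

(* Main.v *)
Require Import Defs.
From HB Require Import structures.
From mathcomp Require Import all_boot all_order.
From mathcomp Require Import boolp classical_sets.

(** In [L/T] every [x] in [L] has a least block [block_below x] with [x] in its
    ideal, and a greatest block [block_above x] with [x] in its filter.  Then
    [x R y] holds iff [block_below x <= block_above y], while the blocks
    [block_below x] are join-dense and the blocks [block_above y] are meet-dense
    in [L/T].  This is exactly the situation in which a context has the
    Dedekind-MacNeille completion of [L/T] as its concept lattice. *)

Set Implicit Arguments.
Unset Strict Implicit.
Unset Printing Implicit Defensive.

Import Order.TTheory.

Local Open Scope classical_set_scope.
Local Open Scope order_scope.

Section DenseContext.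
Context (d : Order.disp_t) (K : porderType d) (G M : Type) (I : set (G * M)).
Variables (g : G -> K) (m : M -> K).
Hypothesis IE : forall x y, I (x, y) <-> g x <= m y.
Hypothesis g_dense :
  forall b c, (forall x, g x <= b -> g x <= c) -> b <= c.
Hypothesis m_dense :
  forall b c, (forall y, c <= m y -> b <= m y) -> b <= c.
Implicit Types A B : DM K.

Lemma cut_down A b c : b <= c -> cut A c -> cut A b.
Proof.
by move=> bc; rewrite -cutP => Ac u uA; apply: le_trans bc _; apply: Ac.
Qed.

(** Cuts are down-closed, so every [g x] below some [a] in [A] has [x] in the preimage; join-density
    of the [g x] then lifts [g x <= m y] to [a <= m y]. *)
Lemma common_attr_preim A :
  common_attr I (g @^-1` A) = m @^-1` ubound A.
Proof.
apply/seteqP; split=> [y Ay a Aa|y uy x Ax]; last exact/IE/uy.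
by apply: g_dense => x xa; apply/IE/Ay; apply: cut_down xa Aa.
Qed.

(** If [u] bounds [A] from above, so does each [m y] above [u]; hence [g x] is below all these
    [m y], and by meet-density below [u]. *)
Lemma common_obj_preim A :
  common_obj I (m @^-1` ubound A) = g @^-1` A.
Proof.
apply/seteqP; split=> [x Ax|x Ax y uy]; last exact/IE/uy.
rewrite /preimage /= -cutP => u uA; apply: m_dense => y uy.
by apply/IE/Ax => a Aa; apply: le_trans uy; apply: uA.
Qed.

Definition concept_of_cut A : concept I :=
  Concept (common_attr_preim A) (common_obj_preim A).

Lemma lboundK (S : set K) : lbound (ubound (lbound S)) = lbound S.
Proof.
apply/seteqP; split=> [a aS s Ss|]; last exact: sub_lbound_ubound.
by apply: aS => b; apply.
Qed.

(** Built from the intent because a set of lower bounds is already a cut, with no closure to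
    take. *)
Definition cut_of_concept (p : concept I) : DM K :=
  Cut (lboundK (m @` intent p)).

Lemma concept_of_cutK : cancel concept_of_cut cut_of_concept.
Proof.
move=> A; apply/cut_inj/seteqP; split=> /= a; last first.
  by move=> Aa _ [y uy <-]; apply: uy.
move=> la; rewrite -cutP => u uA; apply: m_dense => y uy.
by apply: la; exists y => // b Ab; apply: le_trans uy; apply: uA.
Qed.

Lemma cut_of_conceptK : cancel cut_of_concept concept_of_cut.
Proof.
move=> p; apply: extent_inj; rewrite -[RHS]intentK.
apply/seteqP; split=> [x lx y py|x px _ [y py <-]]; last exact/IE/px.
by apply/IE/lx; exists y.
Qed.

Lemma concept_of_cut_bij : bijective concept_of_cut.
Proof. exact: Bijective concept_of_cutK cut_of_conceptK. Qed.

Lemma concept_of_cut_homo : {homo concept_of_cut : A B / A <= B}.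
Proof. by move=> A B /asboolP AB; apply/asboolP => x /AB. Qed.

Lemma concept_of_cutI : {morph concept_of_cut : A B / A `&` B}.
Proof. by move=> A B; apply: extent_inj. Qed.

Lemma concept_of_cutU : {morph concept_of_cut : A B / A `|` B}.
Proof.
(* Joins of concepts intersect intents, so the intents are compared: closing the union of the two
   cuts does not change its upper bounds. *)
move=> A B; apply: extent_inj; rewrite -[LHS]intentK /=; congr common_obj.
apply/seteqP; split=> [y uy|y [uA uB] a]; last first.
  by apply => b [/uA|/uB].
by split=> a Aa; apply/uy/sub_lbound_ubound; [left|right].
Qed.

HB.instance Definition _ := Order.isOrderMorphism.Build
  _ (DM K) _ (concept I) concept_of_cut concept_of_cut_homo.
HB.instance Definition _ := Order.isMeetLatticeMorphism.Build
  _ (DM K) _ (concept I) concept_of_cut concept_of_cutI.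
HB.instance Definition _ := Order.isJoinLatticeMorphism.Build
  _ (DM K) _ (concept I) concept_of_cut concept_of_cutU.

Lemma DM_concept_iso : exists f : {lmorphism DM K -> concept I}, bijective f.
Proof. by exists concept_of_cut; apply: concept_of_cut_bij. Qed.

End DenseContext.

Section FactorBlocks.
Context (d : Order.disp_t) (L : latticeType d) (T : tolerance L).
Implicit Types (B : factor T) (x y : L).

(** For [a] and [b] below [x] and related to [x], meeting [(a, x)] with [(x, b)] gives [(a, b)], so
    these elements form a clique. *)
Lemma block_below_exists x :
  exists B, [set a | a <= x /\ tol_rel T (a, x)] `<=` B.
Proof.
apply: block_exists; split; first by exists x; split=> //; apply: tol_refl.
move=> [a b] /= [[ax aT] [bx bT]].
have bT' := tol_sym bT.
by have := tolI aT bT'; rewrite (meet_l ax) (meet_r bx).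
Qed.

Lemma block_above_exists x :
  exists B, [set a | x <= a /\ tol_rel T (a, x)] `<=` B.
Proof.
apply: block_exists; split; first by exists x; split=> //; apply: tol_refl.
move=> [a b] /= [[xa aT] [xb bT]].
have bT' := tol_sym bT.
by have := tolU aT bT'; rewrite (join_l xa) (join_r xb).
Qed.

Definition block_below x : factor T := sval (cid (block_below_exists x)).

Definition block_above x : factor T := sval (cid (block_above_exists x)).

Lemma block_belowP x B :
  block_below x <= B <-> exists2 b, block B b & x <= b.
Proof.
rewrite /block_below; case: cid => C /= xC; split=> [/factor_leP|[b Bb xb]].
  by apply; apply: xC; split=> //; apply: tol_refl.
(* Meeting [(c, b)] with [(x, x)] relates the witness to [x], since [x] is below [b]. *)
apply/factor_geP => c Bc; exists (x `&` c); last exact: leIr.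
apply: xC; split; first exact: leIl.
by rewrite -{2}(meet_l xb); apply: tolI (tol_refl T x) (block_tol Bc Bb).
Qed.

Lemma block_aboveP x B :
  B <= block_above x <-> exists2 b, block B b & b <= x.
Proof.
rewrite /block_above; case: cid => C /= xC; split=> [/factor_geP|[b Bb bx]].
  by apply; apply: xC; split=> //; apply: tol_refl.
apply/factor_leP => c Bc; exists (x `|` c); last exact: leUr.
apply: xC; split; first exact: leUl.
by rewrite -{2}(join_l bx); apply: tolU (tol_refl T x) (block_tol Bc Bb).
Qed.

Lemma block_below_dense B C :
  (forall x, block_below x <= B -> block_below x <= C) -> B <= C.
Proof.
move=> BC; apply/factor_leP => b Bb.
by apply/block_belowP/BC/block_belowP; exists b.
Qed.

Lemma block_above_dense B C :
  (forall y, C <= block_above y -> B <= block_above y) -> B <= C.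
Proof.
move=> BC; apply/factor_geP => c Cc.
by apply/block_aboveP/BC/block_aboveP; exists c.
Qed.

Lemma le_tol_leE x y :
  rcomp (rcomp (le_rel L) T) (le_rel L) (x, y) <->
  block_below x <= block_above y.
Proof.
split=> [[b /= [a /= xa abT] bT]|].
  (* A block containing both [a] and [b] lies between [block_below x] and [block_above y]. *)
  have [|B abB] := @block_exists _ _ T [set a; b].
    split; first by exists a; left.
    move=> [u v] /= [[->|->] [->|->]] //; try exact: tol_refl.
    exact: tol_sym.
  apply: (@le_trans _ _ B).
    by apply/block_belowP; exists a => //; apply: abB; left.
  by apply/block_aboveP; exists b => //; apply: abB; right.
(* Conversely, [block_above y] itself contains some [c] above [x] and some [b] below [y], and these
   are related as members of one block. *)
move=> /block_belowP[c yc xc].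
have [b yb by_] := (block_aboveP y (block_above y)).1 (lexx _).
by exists b => //; exists c => //; apply: block_tol yc yb.
Qed.

End FactorBlocks.

Theorem theorem3p5 (d : Order.disp_t) (L : latticeType d) (T : tolerance L) :
  let R := rcomp (rcomp (le_rel L) T) (le_rel L) in
  exists f : {lmorphism DM (factor T) -> concept R}, bijective f.
Proof.
exact: DM_concept_iso (@le_tol_leE _ _ T)
  (@block_below_dense _ _ T) (@block_above_dense _ _ T).
Qed.
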